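(* Let $K$ be a field and let $T^*_K$ be any one of $T_K$, $T_K^s$, $T_K^a$. If $K$ is finite then $T^*_K$ is Boolean. If $K$ is infinite then $T^*_K$ is semi-Hausdorff, but not Hausdorff.
   Context: A $K$-bilinear space is a $K$-vector space $V$ with a map $[\cdot,\cdot]:V\times V\to K$ linear in each argument; it is symmetric if $[x,y]=[y,x]$ for all $x,y\in V$, and alternating if $[x,x]=0$ for all $x\in V$. Positive logic: a positive existential formula is built from atomic formulas using $\wedge,\vee,\top,\bot,\exists$; ''formula'' means positive existential formula unless explicitly stated otherwise. An h-inductive sentence has the form $\forall\bar x(\varphi(\bar x)\to\psi(\bar x))$ with $\varphi,\psi$ positive existential formulas; a (positive) theory is a set of h-inductive sentences. A homomorphism is a function between structures preserving truth of formulas; it is an immersion if it also reflects truth of formulas. A model $M$ of $T$ is existentially closed (e.c.) if every homomorphism $f:M\to N$ with $N\models T$ is an immersion. The Kaiser hull $T^{\mathrm{ec}}$ is the set of all h-inductive sentences true in every e.c. model of $T$. For $\bar a$ in an e.c. model $M$, $\mathrm{tp}(\bar a)$ is the set of all formulas without parameters true of $\bar a$ in $M$; a type is a set of this form (equivalently, a maximal consistent set of formulas). A partial type is a consistent set of formulas. A positive theory $T$ is called: - Boolean if every formula in full first-order logic is equivalent to some positive existential formula modulo $T$, or equivalently: for every positive existential formula $\varphi(\bar x)$ there is a positive existential formula $\psi(\bar x)$ that is equivalent to $\neg\varphi(\bar x)$ modulo $T$; - Hausdorff if for any two distinct types $p(\bar x)$ and $q(\bar x)$ there are formulas $\varphi(\bar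 x)\notin p(\bar x)$ and $\psi(\bar x)\notin q(\bar x)$ such that $T^{\mathrm{ec}}\models\forall\bar x(\varphi(\bar x)\vee\psi(\bar x))$; - semi-Hausdorff if equality of types is type-definable, so there is a partial type $\Omega(\bar x,\bar y)$ such that for any $\bar a,\bar b$ in some e.c. model $M$ we have $\mathrm{tp}(\bar a)=\mathrm{tp}(\bar b)$ if and only if $M\models\Omega(\bar a,\bar b)$. $\mathcal L_K$ is the signature consisting of the standard signature of $K$-vector spaces, with a unary function symbol for scalar multiplication by each $\lambda\in K$, a symbol $\neq$ for inequality, and for every $\lambda\in K$ a binary relation symbol written $[x,y]=\lambda$, expressing that the bilinear product of $x$ and $y$ is $\lambda$. Every $K$-bilinear space is naturally viewed as an $\mathcal L_K$-structure. $T_K$, $T_K^s$, $T_K^a$ are the sets of all h-inductive $\mathcal L_K$-sentences true in all $K$-bilinear spaces, all symmetric $K$-bilinear spaces, and all alternating $K$-bilinear spaces, respectively.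
   Formalization: In the definition of Boolean, equivalence of formulas is taken modulo the Kaiser hull T^ec rather than modulo T; modulo T itself the claim fails, since ''all elements are 0'' holds in the zero space, which maps homomorphically to every bilinear space. *)

(* Defs.v *)
From mathcomp Require Import all_boot all_algebra sesquilinear.
From mathcomp Require Import boolp classical_sets cardinality.

Set Implicit Arguments.
Unset Strict Implicit.
Unset Printing Implicit Defensive.

Import GRing.Theory.
Local Open Scope ring_scope.
Local Open Scope classical_set_scope.

(** * Positive logic *)

Record signature := Signature {
  fun_sym : Type;
  fun_arity : fun_sym -> nat;
  rel_sym : Type;
  rel_arity : rel_sym -> nat }.

Record structure (L : signature) := Structure {
  carrier :> Type;
  fun_interp : forall f : fun_sym L, ('I_(fun_arity f) -> carrier) -> carrier;
  rel_interp : forall r : rel_sym L, ('I_(rel_arity r) -> carrier) -> Prop }.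

Section Syntax.
Variable L : signature.

(* Terms and formulas in the variables x_0, ..., x_(n-1). *)
Inductive term (n : nat) : Type :=
| Var of 'I_n
| App (f : fun_sym L) of ('I_(fun_arity f) -> term n).

Inductive atom (n : nat) : Type :=
| Eq of term n & term n
| Rel (r : rel_sym L) of ('I_(rel_arity r) -> term n).

(* Positive existential formulas. A quantifier binds the variable of index 0 of
   its body, the free variable x_i becoming x_(i+1) there. *)
Inductive formula : nat -> Type :=
| Atom n of atom n : formula n
| Top n : formula n
| Bot n : formula n
| And n of formula n & formula n : formula n
| Or n of formula n & formula n : formula n
| Ex n of formula n.+1 : formula n.

(* Arbitrary formulas of full first-order logic. *)
Inductive fo_formula : nat -> Type :=
| FAtom n of atom n : fo_formula n
| FTop n : fo_formula n
| FBot n : fo_formula n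
| FNot n of fo_formula n : fo_formula n
| FAnd n of fo_formula n & fo_formula n : fo_formula n
| FOr n of fo_formula n & fo_formula n : fo_formula n
| FImp n of fo_formula n & fo_formula n : fo_formula n
| FEx n of fo_formula n.+1 : fo_formula n
| FAll n of fo_formula n.+1 : fo_formula n.

(* [HSentence phi psi] is the sentence forall x, phi(x) -> psi(x). *)
Record hsentence := HSentence {
  hs_arity : nat;
  hs_lhs : formula hs_arity;
  hs_rhs : formula hs_arity }.

Definition theory := set hsentence.

End Syntax.

Definition extend (M : Type) (n : nat) (a : 'I_n -> M) (x : M) : 'I_n.+1 -> M :=
  fun i => if unlift ord0 i is Some j then a j else x.

Definition cat_tuples (M : Type) (m n : nat) (a : 'I_m -> M) (b : 'I_n -> M) :
    'I_(m + n) -> M :=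
  fun i => match split i with inl j => a j | inr j => b j end.

Section Semantics.
Variables (L : signature) (M : structure L).

Fixpoint eval n (a : 'I_n -> M) (t : term L n) : M :=
  match t with
  | Var i => a i
  | App _ ts => fun_interp (fun i => eval a (ts i))
  end.

Definition sat_atom n (a : 'I_n -> M) (A : atom L n) : Prop :=
  match A with
  | Eq s t => eval a s = eval a t
  | Rel _ ts => rel_interp (fun i => eval a (ts i))
  end.

Fixpoint sat n (phi : formula L n) : ('I_n -> M) -> Prop :=
  match phi in formula _ k return ('I_k -> M) -> Prop with
  | Atom _ A => fun a => sat_atom a A
  | Top _ => fun _ => True
  | Bot _ => fun _ => False
  | And _ phi1 phi2 => fun a => sat phi1 a /\ sat phi2 a
  | Or _ phi1 phi2 => fun a => sat phi1 a \/ sat phi2 a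
  | Ex _ phi1 => fun a => exists x : M, sat phi1 (extend a x)
  end.

Fixpoint fo_sat n (chi : fo_formula L n) : ('I_n -> M) -> Prop :=
  match chi in fo_formula _ k return ('I_k -> M) -> Prop with
  | FAtom _ A => fun a => sat_atom a A
  | FTop _ => fun _ => True
  | FBot _ => fun _ => False
  | FNot _ chi1 => fun a => ~ fo_sat chi1 a
  | FAnd _ chi1 chi2 => fun a => fo_sat chi1 a /\ fo_sat chi2 a
  | FOr _ chi1 chi2 => fun a => fo_sat chi1 a \/ fo_sat chi2 a
  | FImp _ chi1 chi2 => fun a => fo_sat chi1 a -> fo_sat chi2 a
  | FEx _ chi1 => fun a => exists x : M, fo_sat chi1 (extend a x)
  | FAll _ chi1 => fun a => forall x : M, fo_sat chi1 (extend a x)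
  end.

Definition hs_holds (s : hsentence L) : Prop :=
  forall a : 'I_(hs_arity s) -> M, sat (hs_lhs s) a -> sat (hs_rhs s) a.

Definition models (T : theory L) : Prop := forall s, T s -> hs_holds s.

Definition tp n (a : 'I_n -> M) : set (formula L n) := [set phi | sat phi a].

End Semantics.

Section PositiveModelTheory.
Variable L : signature.

Definition homomorphism (M N : structure L) (f : M -> N) : Prop :=
  forall n (phi : formula L n) (a : 'I_n -> M), sat phi a -> sat phi (f \o a).

Definition immersion (M N : structure L) (f : M -> N) : Prop :=
  homomorphism f /\
  forall n (phi : formula L n) (a : 'I_n -> M), sat phi (f \o a) -> sat phi a.

Definition ec_model (T : theory L) (M : structure L) : Prop :=
  models M T /\
  forall (N : structure L) (f : M -> N),
    models N T -> homomorphism f -> immersion f.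

Definition kaiser_hull (T : theory L) : theory L :=
  [set s | forall M : structure L, ec_model T M -> hs_holds M s].

Definition is_type (T : theory L) n (p : set (formula L n)) : Prop :=
  exists M : structure L, ec_model T M /\ exists a : 'I_n -> M, p = tp a.

Definition partial_type (T : theory L) n (Sigma : set (formula L n)) : Prop :=
  exists M : structure L, models M T /\
    exists a : 'I_n -> M, forall phi, Sigma phi -> sat phi a.

(* Equivalence is taken modulo the Kaiser hull, i.e. in the e.c. models: a
   positive theory matters only through its e.c. models. Modulo the bare theory,
   not even "all elements are equal" would be positively definable for bilinear
   spaces, since it holds in the zero space, which maps to every other space. *)
Definition Boolean (T : theory L) : Prop :=
  forall n (chi : fo_formula L n), exists phi : formula L n,
    forall M : structure L, models M (kaiser_hull T) ->
      forall a : 'I_n -> M, fo_sat chi a <-> sat phi a.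

Definition Hausdorff (T : theory L) : Prop :=
  forall n (p q : set (formula L n)), is_type T p -> is_type T q -> p <> q ->
    exists phi psi : formula L n,
      [/\ ~ p phi, ~ q psi &
        forall M : structure L, models M (kaiser_hull T) ->
          forall a : 'I_n -> M, sat (Or phi psi) a].

Definition semi_Hausdorff (T : theory L) : Prop :=
  forall n : nat, exists Omega : set (formula L (n + n)),
    partial_type T Omega /\
    forall M : structure L, ec_model T M -> forall a b : 'I_n -> M,
      tp a = tp b <-> (forall phi, Omega phi -> sat phi (cat_tuples a b)).

End PositiveModelTheory.

(** * Bilinear spaces *)

Record bilinear_space (K : fieldType) := BilinearSpace {
  bs_space :> lmodType K;
  bs_form : {biscalar bs_space} }.

Definition symmetric_space (K : fieldType) (V : bilinear_space K) : Prop :=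
  forall x y : V, bs_form V x y = bs_form V y x.

Definition alternating_space (K : fieldType) (V : bilinear_space K) : Prop :=
  forall x : V, bs_form V x x = 0.

Inductive LK_fun (K : Type) := Zero | Opp | Add | Scale of K.

Inductive LK_rel (K : Type) := Neq | Prod of K.

Definition LK_fun_arity (K : Type) (f : LK_fun K) : nat :=
  match f with Zero => 0 | Opp => 1 | Add => 2 | Scale _ => 1 end.

Definition LK_rel_arity (K : Type) (r : LK_rel K) : nat := 2.

Definition LK (K : Type) : signature :=
  Signature (@LK_fun_arity K) (@LK_rel_arity K).

Definition LK_fun_interp (K : fieldType) (V : bilinear_space K) (f : LK_fun K) :
    ('I_(LK_fun_arity f) -> V) -> V :=
  match f with
  | Zero => fun _ => 0
  | Opp => fun v => - v ord0
  | Add => fun v => v ord0 + v ord_max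
  | Scale lam => fun v => lam *: v ord0
  end.

Definition LK_rel_interp (K : fieldType) (V : bilinear_space K) (r : LK_rel K)
    (v : 'I_(LK_rel_arity r) -> V) : Prop :=
  match r with
  | Neq => v ord0 <> v ord_max
  | Prod lam => bs_form V (v ord0) (v ord_max) = lam
  end.

Definition LK_structure (K : fieldType) (V : bilinear_space K) :
    structure (LK K) :=
  @Structure (LK K) V (@LK_fun_interp K V) (@LK_rel_interp K V).

Definition theory_of (K : fieldType) (C : bilinear_space K -> Prop) :
    theory (LK K) :=
  [set s | forall V, C V -> hs_holds (LK_structure V) s].

Definition T_bil (K : fieldType) : theory (LK K) := theory_of (fun _ => True).
Definition T_sym (K : fieldType) : theory (LK K) :=
  theory_of (@symmetric_space K).
Definition T_alt (K : fieldType) : theory (LK K) :=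
  theory_of (@alternating_space K).

Arguments T_bil : clear implicits.
Arguments T_sym : clear implicits.
Arguments T_alt : clear implicits.

(* Main.v *)
From HB Require Import structures.
Require Import Defs.
From mathcomp Require Import all_boot all_algebra sesquilinear.
From mathcomp Require Import boolp classical_sets cardinality.
From mathcomp Require Import finmap monalg.

(** The three theories are treated at once: each is the theory of the spaces
whose form obeys a [kind] of law (none, symmetry, alternation), and such laws
survive pullback along a linear map and linear combination of forms
([obeys_pullback], [obeys_comb]). Every auxiliary space below is built from a
given one with these two operations, except the generic space, whose Gram matrix
is made to obey the law.

An e.c. model is a genuine bilinear space ([ec_model_is_space]). A model of the
theory is a vector space in which some products may have no value in K; since
each finite set of facts about it is realised in a bilinear space of the class,
linear extension gives all products values in K at once. In an e.c. space the
type of a tuple is determined by its linear relations and its products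
([ec_transfer]): a partial isometry between two spaces amalgamates them, and the
e.c. one reflects what the amalgam satisfies.

For finite K, there are finitely many patterns of linear relations and products
of an n-tuple, each expressed by a positive formula; so the negation of a
formula is the disjunction of the patterns on which that formula fails in an
e.c. model.

For any K, equality of types is type-definable, because equality of two
products, [x, x'] = [y, y'], is positively definable in e.c. spaces
([same_product]) although the value itself cannot be quantified over: one links
(x, x') to (y, y') through pairs (u, x'), (u, u'), (y, u') having the same
product.

For infinite K, pairs with different products cannot be separated. If a positive
formula holds of pairs with product c for infinitely many c, then two of these,
c and d, can make the same choices at its disjunctions, and it holds of the pair
of pairs in V x V with the form al [ , ] + be [ , ] for every al + be = 1
([infinite_mixing]); there the product is al c + be d, an arbitrary scalar. So
in a rich e.c. space the formula holds of the pairs with any product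
([infinite_everywhere]), and of two formulas covering all pairs, one holds of
all. A rich e.c. space is obtained by freely adjoining vectors with prescribed
products ([generic_space]). *)

Set Implicit Arguments.
Unset Strict Implicit.
Unset Printing Implicit Defensive.

Import GRing.Theory.
Local Open Scope ring_scope.
Local Open Scope classical_set_scope.

(** * Linear extension *)

Section LinearExtension.
Variables (K : fieldType) (V W : lmodType K).

Definition subspace (G : set (V * W)) : Prop :=
  G (0, 0) /\ forall c p q, G p -> G q -> G (c *: p + q).

Definition single_valued (G : set (V * W)) : Prop :=
  forall w, G (0, w) -> w = 0.

(** Zorn's lemma on graphs of partial maps. A vector adjoined to the domain is
sent to 0, so the range never grows; keeping the range inside the span of a
given tuple is what lets the maps built below be computed by coefficients. *)
Lemma linear_extension (G : set (V * W)) :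
    subspace G -> single_valued G ->
  exists s : {linear V -> W},
    (forall v w, G (v, w) -> s v = w) /\ forall v, exists v', G (v', s v).
Proof.
move=> subG funG.
pose good D := [/\ subspace D, single_valued D &
  forall p, D p -> exists v', G (v', p.2)].
have goodG : good G by split=> // -[v w] /= Gvw; exists v.
(* The chains may be empty, so the members are the sets H added to G. *)
have [|H [[[D0 Dlin] Dfun Dim] Hmax]] :=
    @Zorn_bigcup (V * W)%type [set H | good (G `|` H)].
  move=> F FP Ftot.
  have [[H0 FH0]|F0] := pselect (exists H, F H); last first.
    rewrite (_ : \bigcup_(X in F) X = set0) /= ?setU0 //.
    by apply/seteqP; split=> // p [H FH _]; case: F0; exists H.
  have FG p : (G `|` \bigcup_(X in F) X) p -> exists2 H, F H & (G `|` H) p.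
    by case=> [Gp|[H FH Hp]]; [exists H0|exists H] => //; [left|right].
  split.
  - split; first by left; case: subG.
    move=> c p q /FG[H FH Hp] /FG[H' FH' Hq].
    suff [X FX [Xp Xq]] : exists2 X, F X & (G `|` X) p /\ (G `|` X) q.
      have [[_ lin] _ _] := FP _ FX.
      by case: (lin c _ _ Xp Xq) => [|r]; [left|right; exists X].
    have [HH'|H'H] := Ftot _ _ FH FH'.
      by exists H' => //; split=> //; apply: setUS Hp.
    by exists H => //; split=> //; apply: setUS Hq.
  - by move=> w /FG[H FH Hw]; have [_ + _] := FP _ FH; apply.
  - by move=> p /FG[H FH Hp]; have [_ _] := FP _ FH; apply.
set D := G `|` H in D0 Dlin Dfun Dim.
have DZ c p : D p -> D (c *: p).
  by move=> Dp; rewrite -[c *: p]addr0; apply: Dlin.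
have Dinj v w w' : D (v, w) -> D (v, w') -> w = w'.
  move=> /(Dlin (-1) _ _) /[apply]; rewrite scaleN1r.
  have -> : - (v, w) + (v, w') = (- v + v, - w + w') by [].
  by rewrite addNr => /Dfun /eqP; rewrite addrC subr_eq0 => /eqP.
have Dtot v : exists w, D (v, w).
  have [//|nv] := pselect (exists w, D (v, w)).
  pose D' := [set p : V * W | exists c, D (p.1 - c *: v, p.2)].
  have DD' : D `<=` D'.
    by move=> [u w] Duw; exists 0; rewrite /= scale0r subr0.
  have goodD' : good D'.
    split.
    - split; first exact: DD'.
      move=> c [u w] [u' w'] /= [d Du] [d' Du']; exists (c * d + d') => /=.
      have := Dlin c _ _ Du Du'; congr (D (_, _)) => /=.
      by rewrite scalerDl scalerBr scalerA opprD addrACA.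
    - move=> w [c /= Dc]; have [c0|c0] := eqVneq c 0.
        by apply: Dfun; move: Dc; rewrite c0 scale0r subr0.
      case: nv; exists (- c^-1 *: w).
      have := DZ (- c^-1) _ Dc; congr (D (_, _)) => /=.
      by rewrite sub0r scalerN scaleNr opprK scalerA mulVf ?scale1r.
    - by move=> p [c Dc]; have := Dim _ Dc.
  suff HD' : H `<` D'.
    case: (Hmax D' HD'); rewrite /= (_ : G `|` D' = D') //.
    by apply/seteqP; split=> [p [Gp|//]|p ?]; [apply: DD'; left|right].
  split; first by move=> p Hp; apply: DD'; right.
  move=> /(_ (v, 0)) D'H; apply: nv; exists 0; right; apply: D'H.
  by exists 1; rewrite /= scale1r subrr; apply: D0.
have [s sD] := choice Dtot.
have s_lin : linear s.
  by move=> c u v; apply: Dinj (sD _) _; have := Dlin c _ _ (sD u) (sD v).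
pose S : {linear V -> W} :=
  HB.pack s (GRing.isLinear.Build K V W *:%R s s_lin).
exists S; split=> [v w Gvw|v]; first by apply: Dinj (sD v) _; left.
by have [v' Gv'] := Dim _ (sD v); exists v'.
Qed.

End LinearExtension.

Lemma tuple_extension (K : fieldType) (V W : lmodType K) n
    (a : 'I_n -> V) (b : 'I_n -> W) :
    (forall c : 'I_n -> K, \sum_i c i *: a i = 0 -> \sum_i c i *: b i = 0) ->
  exists s : {linear V -> W}, (forall i, s (a i) = b i) /\
    forall v, exists c : 'I_n -> K, s v = \sum_i c i *: b i.
Proof.
move=> ab.
pose G := [set p : V * W | exists c : 'I_n -> K,
  p = (\sum_i c i *: a i, \sum_i c i *: b i)].
have [|w [c [/esym/ab -> ->]] //|s [sG sim]] := @linear_extension K V W G.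
  split; first by exists (fun=> 0); rewrite !big1 // => i _; rewrite scale0r.
  move=> c p q [d ->] [e ->]; exists (fun i => c * d i + e i).
  congr pair; rewrite /= scaler_sumr -big_split; apply: eq_bigr => i _;
    by rewrite scalerDl scalerA.
exists s; split=> [i|v]; last by have [v' [c [_ ->]]] := sim v; exists c.
apply: sG; exists (fun j => (j == i)%:R).
congr pair; rewrite (bigD1 i) //= eqxx scale1r big1 ?addr0 // => j /negPf ->;
  by rewrite scale0r.
Qed.

(** * Bilinear spaces and isometric tuples *)

Section Forms.
Variable K : fieldType.

Definition space_of (U : lmodType K) (B : U -> U -> K)
    (linB : bilinear_for *%R *%R B) : bilinear_space K :=
  BilinearSpace (HB.pack_for {biscalar U} B
    (bilinear_isBilinear.Build K U U K *%R *%R B linB)).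

Lemma form_linl (V : bilinear_space K) c (u u' v : V) :
  bs_form V (c *: u + u') v = c * bs_form V u v + bs_form V u' v.
Proof. exact: linearPl. Qed.

Lemma form_linr (V : bilinear_space K) c (u u' v : V) :
  bs_form V v (c *: u + u') = c * bs_form V v u + bs_form V v u'.
Proof. exact: linearPr. Qed.

Lemma form_suml (V : bilinear_space K) n (c : 'I_n -> K) (a : 'I_n -> V) v :
  bs_form V (\sum_i c i *: a i) v = \sum_i c i * bs_form V (a i) v.
Proof.
by rewrite linear_sumlz; apply: eq_bigr => i _; rewrite linearZl_LR.
Qed.

Lemma form_sumr (V : bilinear_space K) n (c : 'I_n -> K) (a : 'I_n -> V) v :
  bs_form V v (\sum_i c i *: a i) = \sum_i c i * bs_form V v (a i).
Proof.
by rewrite linear_sumr; apply: eq_bigr => i _; rewrite linearZr_LR.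
Qed.

Inductive kind := Arbitrary | Symmetric | Alternating.

Definition obeys (k : kind) (U : Type) (B : U -> U -> K) : Prop :=
  match k with
  | Arbitrary => True
  | Symmetric => forall x y, B x y = B y x
  | Alternating => forall x, B x x = 0
  end.

Definition in_class (k : kind) (V : bilinear_space K) : Prop :=
  obeys k (bs_form V).

Lemma obeys_pullback k (U U' : Type) (f : U -> U') (B : U' -> U' -> K) :
  obeys k B -> obeys k (fun x y => B (f x) (f y)).
Proof. by case: k => //= HB *; apply: HB. Qed.

Lemma obeys_comb k (U : Type) c (B B' : U -> U -> K) :
  obeys k B -> obeys k B' -> obeys k (fun x y => c * B x y + B' x y).
Proof.
case: k => //= hB hB' x => [y|]; first by rewrite hB hB'.
by rewrite hB hB' mulr0 addr0.
Qed.

Lemma bilinear_pullback (U U' : lmodType K) (f : U -> U') (B : U' -> U' -> K) :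
  linear f -> bilinear_for *%R *%R B ->
  bilinear_for *%R *%R (fun x y => B (f x) (f y)).
Proof.
by move=> linf [Bl Br]; split=> u c x y /=; rewrite linf ?Bl ?Br.
Qed.

Lemma bilinear_comb (U : lmodType K) c (B B' : U -> U -> K) :
  bilinear_for *%R *%R B -> bilinear_for *%R *%R B' ->
  bilinear_for *%R *%R (fun x y => c * B x y + B' x y).
Proof.
move=> [Bl Br] [Bl' Br']; split=> u d x y /=.
  by rewrite Bl Bl' /= !mulrDr !mulrA [c * d]mulrC addrACA.
by rewrite Br Br' /= !mulrDr !mulrA [c * d]mulrC addrACA.
Qed.

Lemma form_bilinear (V : bilinear_space K) : bilinear_for *%R *%R (bs_form V).
Proof. by split=> u c x y /=; rewrite ?form_linl ?form_linr. Qed.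

Lemma alternating_antisym (V : bilinear_space K) (x y : V) :
  alternating_space V -> bs_form V y x = - bs_form V x y.
Proof.
move=> alt; have := alt (x + y).
rewrite linearDl !linearDr !alt addr0 add0r => /eqP.
by rewrite addrC addr_eq0 => /eqP.
Qed.

End Forms.

Section Tuples.
Variables (K : fieldType) (V W : bilinear_space K).

(** These data determine the atoms that a tuple satisfies ([isometric_atom]),
since every term is a linear combination of the variables. *)
Definition isometric n (a : 'I_n -> V) (b : 'I_n -> W) : Prop :=
  (forall c : 'I_n -> K, \sum_i c i *: a i = 0 <-> \sum_i c i *: b i = 0) /\
  forall i j, bs_form V (a i) (a j) = bs_form W (b i) (b j).

Lemma isometric_comb_eq n (a : 'I_n -> V) (b : 'I_n -> W)
    (c d : 'I_n -> K) : isometric a b ->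
  \sum_i c i *: a i = \sum_i d i *: a i <-> \sum_i c i *: b i = \sum_i d i *: b i.
Proof.
move=> [lin _]; have := lin (fun i => c i - d i).
have E (U : lmodType K) (x : 'I_n -> U) :
    \sum_i (c i - d i) *: x i = \sum_i c i *: x i - \sum_i d i *: x i.
  by rewrite -sumrB; apply: eq_bigr => i _; rewrite scalerBl.
by rewrite !E => -[ab ba]; split=> /eqP; rewrite -subr_eq0 => /eqP H;
  apply: subr0_eq; [exact: ab|exact: ba].
Qed.

Lemma isometric_comb_form n (a : 'I_n -> V) (b : 'I_n -> W)
    (c d : 'I_n -> K) : isometric a b ->
  bs_form V (\sum_i c i *: a i) (\sum_i d i *: a i) =
  bs_form W (\sum_i c i *: b i) (\sum_i d i *: b i).
Proof.
move=> [_ prod]; rewrite !form_suml; apply: eq_bigr => i _; congr (_ * _).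
by rewrite !form_sumr; apply: eq_bigr => j _; rewrite prod.
Qed.

End Tuples.

Lemma isometric_sym (K : fieldType) (V W : bilinear_space K) n
    (a : 'I_n -> V) (b : 'I_n -> W) : isometric a b -> isometric b a.
Proof. by move=> [l p]; split=> [c|i j]; [split=> /l|rewrite p]. Qed.

Section Atoms.
Variable K : fieldType.

Lemma term_linear n (t : term (LK K) n) : exists c : 'I_n -> K,
  forall (V : bilinear_space K) (a : 'I_n -> V),
    eval (M := LK_structure V) a t = \sum_i c i *: a i.
Proof.
elim: t => [i|f ts IH].
  exists (fun j => (j == i)%:R) => V a; rewrite (bigD1 i) //= eqxx scale1r.
  by rewrite big1 ?addr0 // => j /negPf ->; rewrite scale0r.
have {}IH i := cid (IH i); case: f ts IH => [| | |x] ts IH.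
- exists (fun=> 0) => V a; rewrite big1 // => i _; exact: scale0r.
- exists (fun i => - sval (IH ord0) i) => V a /=.
  rewrite (svalP (IH ord0)) -sumrN.
  by apply: eq_bigr => i _; rewrite scaleNr.
- exists (fun i => sval (IH ord0) i + sval (IH ord_max) i) => V a /=.
  rewrite (svalP (IH ord0)) (svalP (IH ord_max)) -big_split.
  by apply: eq_bigr => i _; rewrite scalerDl.
- exists (fun i => x * sval (IH ord0) i) => V a /=.
  rewrite (svalP (IH ord0)) scaler_sumr.
  by apply: eq_bigr => i _; rewrite scalerA.
Qed.

Lemma isometric_atom (V W : bilinear_space K) n (a : 'I_n -> V) (b : 'I_n -> W)
    (A : atom (LK K) n) : isometric a b ->
  sat_atom (M := LK_structure V) a A <-> sat_atom (M := LK_structure W) b A.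
Proof.
move=> iso; case: A => [s t|[|x] ts] /=.
- have [c cE] := term_linear s; have [d dE] := term_linear t.
  by rewrite !cE !dE; exact: isometric_comb_eq.
- have [c cE] := term_linear (ts ord0).
  have [d dE] := term_linear (ts ord_max).
  rewrite !cE !dE; have [ab ba] := isometric_comb_eq c d iso.
  by split=> H; [move/ba|move/ab].
- have [c cE] := term_linear (ts ord0).
  have [d dE] := term_linear (ts ord_max).
  by rewrite !cE !dE (isometric_comb_form _ _ iso).
Qed.

End Atoms.

Lemma homomorphism_of_atoms (L : signature) (M N : structure L) (f : M -> N) :
    (forall g v, f (fun_interp (s := M) (f := g) v) = fun_interp (f \o v)) ->
    (forall r v, rel_interp (s := M) (r := r) v -> rel_interp (f \o v)) ->
  homomorphism f.
Proof.
move=> fF fR.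
have fE n (a : 'I_n -> M) t : f (eval a t) = eval (f \o a) t.
  by elim: t => [//|g ts IH] /=; rewrite fF; congr fun_interp; apply/funext.
move=> n phi; elim: {n} phi =>
  [n [s t|r ts]|||n p IHp q IHq|n p IHp q IHq|n p IHp] a //=.
- by rewrite -!fE => ->.
- move=> /fR; congr rel_interp; apply/funext => i /=; exact: fE.
- by move=> [/IHp ? /IHq].
- by move=> [/IHp|/IHq]; [left|right].
- move=> [x /IHp px]; exists (f x); move: px; congr sat; apply/funext => i.
  by rewrite /extend /=; case: unlift.
Qed.

(** * Finite realisation of the facts of a model *)

Section FreeSpace.
Variables (K : fieldType) (I : choiceType).
Implicit Types (h : I -> K) (u v : {malg K[I]}).

Definition lin_ext h u : K := mmap idfun h u.

Lemma lin_extU h i : lin_ext h << i >> = h i.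
Proof. by rewrite /lin_ext mmapU mul1r. Qed.

Lemma lin_extP h c u v :
  lin_ext h (c *: u + v) = c * lin_ext h u + lin_ext h v.
Proof.
rewrite /lin_ext mmapD; congr (_ + _).
rewrite (mmapEw (msuppZ_le c u)) mmapE mulr_sumr; apply: eq_bigr => k _ /=.
by rewrite mcoeffZ mulrA.
Qed.

End FreeSpace.

Section Facts.
Variables (L : signature) (M : structure L).

Record fact := Fact {
  fact_arity : nat;
  fact_atom : atom L fact_arity;
  fact_params : 'I_fact_arity -> M }.
Arguments fact_params : clear implicits.

Definition fact_holds (N : structure L) (theta : M -> N) (F : fact) : Prop :=
  sat_atom (theta \o fact_params F) (fact_atom F).

Definition all_hold (N : structure L) (theta : M -> N) (Fs : seq fact) : Prop :=
  foldr (fun F P => fact_holds theta F /\ P) True Fs.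

Lemma all_hold_cat (N : structure L) (theta : M -> N) Fs Fs' :
  all_hold theta (Fs ++ Fs') <-> all_hold theta Fs /\ all_hold theta Fs'.
Proof. by elim: Fs => /= [|F Fs ->]; tauto. Qed.

Fixpoint rename n m (rho : 'I_n -> 'I_m) (t : term L n) : term L m :=
  match t with
  | Var i => Var L (rho i)
  | App f ts => App (fun i => rename rho (ts i))
  end.

Definition rename_atom n m (rho : 'I_n -> 'I_m) (A : atom L n) : atom L m :=
  match A with
  | Eq s t => Eq (rename rho s) (rename rho t)
  | Rel r ts => Rel (fun i => rename rho (ts i))
  end.

Lemma eval_rename (N : structure L) n m (rho : 'I_n -> 'I_m) (a : 'I_m -> N) t :
  eval a (rename rho t) = eval (a \o rho) t.
Proof. by elim: t => [//|f ts IH] /=; congr fun_interp; apply/funext. Qed.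

Lemma sat_rename (N : structure L) n m (rho : 'I_n -> 'I_m) (a : 'I_m -> N) A :
  sat_atom a (rename_atom rho A) <-> sat_atom (a \o rho) A.
Proof.
case: A => [s t|r ts] /=; first by rewrite !eval_rename.
rewrite (_ : (fun i => _) = (fun i => eval (a \o rho) (ts i))) //.
by apply/funext => i; rewrite eval_rename.
Qed.

(** Otherwise the sentence saying that these facts are contradictory would
belong to [T]. The facts may share parameters, so one variable is used for each
element of [M] that occurs in them. *)
Lemma realize_facts (x0 : M) (T : theory L) (C : structure L -> Prop)
    (Fs : seq fact) :
    (forall s, (forall N, C N -> hs_holds N s) -> T s) -> models M T ->
    all_hold (N := M) id Fs ->
  exists2 N, C N & exists theta : M -> N, all_hold theta Fs.
Proof.
move=> TC MT MFs.
pose X : seq {classic M} :=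
  flatten [seq [seq fact_params F i | i <- enum 'I_(fact_arity F)] | F <- Fs].
(* The additional index makes the type of variables inhabited, as [inord]
   requires; elements outside [X] are sent there. *)
pose rho (x : M) : 'I_(size X).+1 := inord (index (x : {classic M}) X).
pose m (j : 'I_(size X).+1) : M := nth (x0 : {classic M}) X j.
pose phi Gs := foldr (fun F p =>
  And (Atom (rename_atom (rho \o fact_params F) (fact_atom F))) p) (Top L _) Gs.
have satphi (N : structure L) (a : 'I_(size X).+1 -> N) Gs :
    sat (phi Gs) a <-> all_hold (a \o rho) Gs.
  by elim: Gs => [//|F Gs /= ->]; rewrite sat_rename.
have mK : all_hold (m \o rho) Fs.
  have {MFs} : all_hold id Fs := MFs.
  have : {subset flatten [seq [seq (fact_params F i : {classic M}) |
      i <- enum 'I_(fact_arity F)] | F <- Fs] <= X} by [].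
  elim: (Fs) => [//|G Gs IH] /= sub [MG /IH{IH} IH]; split; last first.
    by apply: IH => x xG; apply: sub; rewrite mem_cat xG orbT.
  rewrite /fact_holds (_ : _ \o _ = fact_params G) //; apply/funext => i /=.
  have Xi : (fact_params G i : {classic M}) \in X.
    by apply: sub; rewrite mem_cat map_f // mem_enum.
  by rewrite /m /rho inordK ?nth_index // ltnS index_size.
apply: contrapT => nC.
have /MT : T (HSentence (phi Fs) (Bot L _)).
  apply: TC => N CN a /= /satphi aFs; apply: nC; exists N => //.
  by exists (a \o rho).
by move=> /(_ m); apply; apply/satphi.
Qed.

End Facts.

(** * The models of the theories *)

Section Theories.
Variables (K : fieldType) (k : kind).

Definition T_kind : theory (LK K) := theory_of (@in_class K k).

Definition tZero n : term (LK K) n :=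
  @App (LK K) n (Zero K) (fun i : 'I_0 => False_rect _ (notF (ltn_ord i))).
Definition pair_fun (T : Type) (x y : T) (i : 'I_2) : T :=
  if i == ord0 then x else y.
Definition tAdd n (s t : term (LK K) n) : term (LK K) n :=
  @App (LK K) n (Add K) (pair_fun s t).
Definition tOpp n (s : term (LK K) n) : term (LK K) n :=
  @App (LK K) n (Opp K) (fun _ : 'I_1 => s).
Definition tScale n (c : K) (s : term (LK K) n) : term (LK K) n :=
  @App (LK K) n (Scale c) (fun _ : 'I_1 => s).
Definition aProd n (c : K) (s t : term (LK K) n) : atom (LK K) n :=
  @Rel (LK K) n (Prod c) (pair_fun s t).
Definition aNeq n (s t : term (LK K) n) : atom (LK K) n :=
  @Rel (LK K) n (Neq K) (pair_fun s t).

Definition triple (T : Type) (x y z : T) (i : 'I_3) : T := nth x [:: x; y; z] i.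

Section Model.
Variables (M : structure (LK K)) (MT : models M T_kind).

Definition zeroM : M :=
  @fun_interp _ M (Zero K) (fun i : 'I_0 => False_rect _ (notF (ltn_ord i))).
Definition addM (x y : M) : M := @fun_interp _ M (Add K) (pair_fun x y).
Definition oppM (x : M) : M := @fun_interp _ M (Opp K) (fun _ : 'I_1 => x).
Definition scaleM c (x : M) : M := @fun_interp _ M (Scale c) (fun _ : 'I_1 => x).

Lemma eval_zero n (a : 'I_n -> M) : eval a (tZero n) = zeroM.
Proof. by congr fun_interp; apply/funext => -[]. Qed.
Lemma eval_add n (a : 'I_n -> M) s t :
  eval a (tAdd s t) = addM (eval a s) (eval a t).
Proof.
by congr fun_interp; apply/funext => i; rewrite /pair_fun; case: eqP.
Qed.
Lemma eval_opp n (a : 'I_n -> M) s : eval a (tOpp s) = oppM (eval a s).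
Proof. by []. Qed.
Lemma eval_scale n (a : 'I_n -> M) c s :
  eval a (tScale c s) = scaleM c (eval a s).
Proof. by []. Qed.
Definition evalE := (eval_zero, eval_add, eval_opp, eval_scale).

Lemma model_identity n (s t : term (LK K) n) :
    (forall (V : bilinear_space K) (a : 'I_n -> V),
       eval (M := LK_structure V) a s = eval (M := LK_structure V) a t) ->
  forall a : 'I_n -> M, eval a s = eval a t.
Proof.
move=> st a.
have /MT/(_ a I) // : T_kind (HSentence (Top _ n) (Atom (Eq s t))).
by move=> V _ b _; apply: st.
Qed.

Local Notation X := (Var (LK K) (inord 0 : 'I_3)).
Local Notation Y := (Var (LK K) (inord 1 : 'I_3)).
Local Notation Z := (Var (LK K) (inord 2 : 'I_3)).

Lemma eval_triple (x y z : M) : (eval (triple x y z) X = x) *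
  (eval (triple x y z) Y = y) * (eval (triple x y z) Z = z).
Proof. by rewrite /= /triple !inordK. Qed.

Lemma addMA : associative addM.
Proof.
move=> x y z; have := @model_identity _ (tAdd X (tAdd Y Z)) (tAdd (tAdd X Y) Z).
move=> /(_ _ (triple x y z)); rewrite !evalE !eval_triple; apply.
by move=> V a; apply: addrA.
Qed.
Lemma addMC : commutative addM.
Proof.
move=> x y; have := @model_identity _ (tAdd X Y) (tAdd Y X).
move=> /(_ _ (triple x y y)); rewrite !evalE !eval_triple; apply.
by move=> V a; apply: addrC.
Qed.
Lemma add0M : left_id zeroM addM.
Proof.
move=> x; have := @model_identity _ (tAdd (tZero 3) X) X.
move=> /(_ _ (triple x x x)); rewrite !evalE !eval_triple; apply.
by move=> V a; apply: add0r.
Qed.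
Lemma addNM : left_inverse zeroM oppM addM.
Proof.
move=> x; have := @model_identity _ (tAdd (tOpp X) X) (tZero 3).
move=> /(_ _ (triple x x x)); rewrite !evalE !eval_triple; apply.
by move=> V a; apply: addNr.
Qed.
Lemma scaleMA c d x : scaleM c (scaleM d x) = scaleM (c * d) x.
Proof.
have := @model_identity _ (tScale c (tScale d X)) (tScale (c * d) X).
move=> /(_ _ (triple x x x)); rewrite !evalE !eval_triple; apply.
by move=> V a; apply: scalerA.
Qed.
Lemma scale1M : left_id 1 scaleM.
Proof.
move=> x; have := @model_identity _ (tScale 1 X) X.
move=> /(_ _ (triple x x x)); rewrite !evalE !eval_triple; apply.
by move=> V a; apply: scale1r.
Qed.
Lemma scaleMDr : right_distributive scaleM addM.
Proof.
move=> c x y.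
have := @model_identity _ (tScale c (tAdd X Y)) (tAdd (tScale c X) (tScale c Y)).
move=> /(_ _ (triple x y y)); rewrite !evalE !eval_triple; apply.
by move=> V a; apply: scalerDr.
Qed.
Lemma scaleMDl x : {morph scaleM^~ x : c d / c + d >-> addM c d}.
Proof.
move=> c d.
have := @model_identity _ (tScale (c + d) X) (tAdd (tScale c X) (tScale d X)).
move=> /(_ _ (triple x x x)); rewrite !evalE !eval_triple; apply.
by move=> V a; apply: scalerDl.
Qed.

(** The carrier of [M]; its structure of vector space depends on the proof that [M]
is a model, which therefore has to be recorded in the type. *)
Definition vectors : Type := let _ := MT in carrier M.
HB.instance Definition _ := gen_eqMixin vectors.
HB.instance Definition _ := gen_choiceMixin vectors.
HB.instance Definition _ := GRing.isZmodule.Build vectors addMA addMC add0M addNM.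
HB.instance Definition _ := GRing.Zmodule_isLmodule.Build K vectors
  scaleMA scale1M scaleMDr scaleMDl.

Local Notation U := (vectors : lmodType K).
Local Notation pairs := {malg K[(vectors * vectors)%type]}.

(** In the free space on pairs of elements of [M], the image of the basis vector
[<< (x, y) >>] under a linear functional stands for the product of x and y; a
map [theta] to a bilinear space proposes such values. *)
Definition product_functional (V : bilinear_space K) (theta : M -> V) : pairs -> K :=
  lin_ext (fun p : vectors * vectors => bs_form V (theta p.1) (theta p.2)).

(** Because the constraints on the form are expressed through all the proposals
that respect finitely many facts, and not through a list of equations, they are
a subspace at once. *)
Definition forced : set (pairs * K^o) := [set p : pairs * K^o |
  exists2 Fs : seq (fact M), all_hold (N := M) id Fs &
    forall (V : bilinear_space K) (theta : M -> V), in_class k V ->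
      all_hold (N := LK_structure V) theta Fs ->
      product_functional theta p.1 = p.2].

Lemma forced_subspace : subspace forced.
Proof.
split.
  exists nil => // V theta _ _ /=; rewrite /product_functional.
  exact: mmap0.
move=> c p q [Fs MFs pF] [Gs MGs qG].
exists (Fs ++ Gs) => [|V theta CV]; first exact/all_hold_cat.
move=> /all_hold_cat[/(pF _ _ CV) pE /(qG _ _ CV) qE].
by rewrite /product_functional lin_extP -!/(product_functional _ _) pE qE.
Qed.

(** The facts that would impose a nonzero value at 0 can be realised in a space
of the class, where the functional is linear. *)
Lemma forced_single_valued : single_valued forced.
Proof.
move=> w [Fs MFs wF].
have [|N [V CV ->{N}] [theta thetaF]] :=
    @realize_facts _ _ zeroM T_kind
      (fun N => exists2 V, in_class k V & N = LK_structure V) Fs _ MT MFs.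
  by move=> s Cs V CV; apply: Cs; exists V.
by have /= <- := wF _ _ CV thetaF; apply: mmap0.
Qed.

(** Any linear functional extending [forced] gives the form: bilinearity and the
law are themselves forced, by the linear equations that hold in [M] and by no
facts at all, respectively. *)
Lemma model_form : exists B : vectors -> vectors -> K,
  [/\ bilinear_for *%R *%R B, obeys k B &
    forall c x y, @rel_interp _ M (Prod c) (pair_fun x y) -> B x y = c].
Proof.
have [s [sG _]] := linear_extension forced_subspace forced_single_valued.
pose B (x y : vectors) : K := s << (x, y) >>.
have linear_fact c (x y : M) : exists2 F : fact M, fact_holds (N := M) id F &
    forall (V : bilinear_space K) (theta : M -> V),
      fact_holds (N := LK_structure V) theta F ->
      theta (addM (scaleM c x) y) = c *: theta x + theta y.
  exists (Fact (Eq (tAdd (tScale c X) Y) Z) (triple x y (addM (scaleM c x) y))).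
    suff : eval (triple x y (addM (scaleM c x) y)) (tAdd (tScale c X) Y) =
        eval (triple x y (addM (scaleM c x) y)) Z by [].
    by rewrite !evalE !eval_triple.
  by move=> V theta; rewrite /fact_holds /= /triple /= !inordK.
exists B; split.
- split=> y c x x'; apply/eqP; rewrite -subr_eq0; apply/eqP.
    have [F MF FE] := linear_fact c x x'.
    have := sG (<< (c *: x + x', y) >> - (c *: << (x, y) >> + << (x', y) >>)) 0.
    rewrite linearB (linearP s) => H; apply: H.
  exists [:: F] => // V theta _ [/(FE V theta) E _] /=.
    rewrite /product_functional -scaleN1r addrC !lin_extP !lin_extU /=.
    by rewrite (_ : theta (c *: x + x' : vectors) = c *: theta x + theta x') //
      form_linl mulN1r addNr.
  have [F MF FE] := linear_fact c x x'.
  have := sG (<< (y, c *: x + x') >> - (c *: << (y, x) >> + << (y, x') >>)) 0.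
  rewrite linearB (linearP s) => H; apply: H.
  exists [:: F] => // V theta _ [/(FE V theta) E _] /=.
  rewrite /product_functional -scaleN1r addrC !lin_extP !lin_extU /=.
  by rewrite (_ : theta (c *: x + x' : vectors) = c *: theta x + theta x') //
      form_linr mulN1r addNr.
- have law u : (forall (V : bilinear_space K) (theta : M -> V), in_class k V ->
      product_functional theta u = 0) -> s u = 0.
    by move=> u0; apply: sG; exists nil => // V theta /u0.
  rewrite /obeys; case: (k) law => // law.
    move=> x y; apply/eqP; rewrite -subr_eq0 -linearB; apply/eqP/law => V theta CV.
    rewrite /product_functional -scaleN1r addrC !lin_extP !lin_extU /=.
    by rewrite CV mulN1r addNr.
  move=> x; apply: law => V theta CV.
  by rewrite /product_functional lin_extU; apply: CV.
- move=> c x y xyc; apply: sG.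
  exists [:: Fact (aProd c X Y) (triple x y x)].
    split=> //; rewrite /fact_holds /=; move: xyc; congr rel_interp.
    apply/funext => i; rewrite /pair_fun; case: eqP => _ /=;
    by rewrite /triple inordK.
  move=> V theta _ [+ _]; rewrite /fact_holds /= /triple /= !inordK // => E.
  by rewrite /product_functional lin_extU.
Qed.

End Model.

End Theories.

(** * Existentially closed models *)

Section ECModels.
Variables (K : fieldType) (k : kind).

Local Notation T := (@T_kind K k).
Local Notation LKs := (@LK_structure K).

Lemma structure_eta (L : signature) (M : structure L) F :
  @fun_interp L M = F -> M = @Structure L M F (@rel_interp L M).
Proof. by case: M F => M F R F' /= <-. Qed.

Lemma class_models (V : bilinear_space K) : in_class k V -> models (LKs V) T.
Proof. by move=> CV s; apply. Qed.

(** Only products may be missing from a model, never be wrong; so the identity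
is a homomorphism from it to a space of the class. *)
Lemma model_is_weak_space (M : structure (LK K)) : models M T ->
  exists2 W : bilinear_space K, in_class k W & exists2 R,
    M = @Structure (LK K) W (@LK_fun_interp K W) R &
    forall r v, R r v -> @LK_rel_interp K W r v.
Proof.
move=> MT; have [B [Blin Bk Bprod]] := model_form MT.
have pairE (v : 'I_2 -> M) : v = pair_fun (v ord0) (v ord_max).
  apply/funext => -[[|[|//]] lt]; rewrite /pair_fun -val_eqE /=; congr v;
    exact: val_inj.
exists (space_of Blin) => //; exists (@rel_interp _ M).
  apply: structure_eta; apply/functional_extensionality_dep => f.
  apply/funext => v; case: f v => [||| c] v /=.
  - by congr fun_interp; apply/funext => -[].
  - by congr fun_interp; apply/funext => i; rewrite ord1.
  - by rewrite [v in LHS]pairE.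
  - by congr fun_interp; apply/funext => i; rewrite ord1.
case=> [|c] v /=; last by rewrite {1}[v]pairE; apply: Bprod.
move=> vneq veq.
have : T (HSentence (And (Atom (@Rel (LK K) 2 (Neq K) (Var (LK K) (n := 2))))
    (Atom (Eq (Var (LK K) ord0) (Var (LK K) ord_max)))) (Bot _ 2)).
  by move=> V _ a [].
by move=> /MT/(_ v); apply.
Qed.

Lemma ec_model_is_space (M : structure (LK K)) : ec_model T M ->
  exists2 W : bilinear_space K, in_class k W & M = LKs W.
Proof.
move=> [/model_is_weak_space[W CW [R -> RW]] ecM]; exists W => //.
have homW : homomorphism (M := @Structure (LK K) W (@LK_fun_interp K W) R)
    (N := LKs W) id.
  exact: homomorphism_of_atoms.
have [_ imm] := ecM _ _ (class_models CW) homW.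
congr Structure; apply/functional_extensionality_dep => r; apply/funext => v.
apply/propext; split; first exact: RW.
exact: (imm _ (Atom (@Rel (LK K) _ r (Var (LK K) (n := _)))) v).
Qed.

Lemma isometry_homomorphism (V W : bilinear_space K) (f : V -> W) :
    linear f -> injective f ->
    (forall x y, bs_form W (f x) (f y) = bs_form V x y) ->
  homomorphism (M := LKs V) (N := LKs W) f.
Proof.
move=> linf injf isof.
pose F : {linear V -> W} := HB.pack f (GRing.isLinear.Build K V W *:%R f linf).
apply: homomorphism_of_atoms => [[||| c] v|[|c] v] /=.
- exact: (linear0 F).
- exact: (linearN F).
- exact: (linearD F).
- exact: (linearZ_LR F).
- by move=> vneq /injf.
- by rewrite isof.
Qed.

(** Amalgamation over the tuples. Let p project [V] onto the span of a, s carry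
that span to the span of b, and r bring it back. The amalgam is [W * V], into
which v is sent as (s (p v), v - p v) and w as (w, 0). Its form gives (w, v) and
(w', v') the product [w, w'] in [W], plus the products in [V] of r w + v and r
w' + v', minus the product of r w and r w' already counted in [W]. Then a and b
have the same image, and [W] reflects the truth of [phi] there. *)
Lemma ec_transfer (V W : bilinear_space K) n (a : 'I_n -> V) (b : 'I_n -> W) phi :
    in_class k V -> in_class k W -> ec_model T (LKs W) -> isometric a b ->
  sat (M := LKs V) phi a -> sat (M := LKs W) phi b.
Proof.
move=> CV CW [_ ecW] [ab prod].
have [p [pa pim]] := tuple_extension (fun c (h : \sum_i c i *: a i = 0) => h).
have [s [sa _]] := tuple_extension (fun c h => (ab c).1 h).
have [r [rb _]] := tuple_extension (fun c h => (ab c).2 h).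
have sE c : s (\sum_i c i *: a i) = \sum_i c i *: b i.
  by rewrite linear_sum; apply: eq_bigr => i _; rewrite linearZ /= sa.
have rsp v : r (s (p v)) = p v.
  have [c ->] := pim v; rewrite sE linear_sum; apply: eq_bigr => i _.
  by rewrite linearZ /= rb.
have sp_form v v' : bs_form W (s (p v)) (s (p v')) = bs_form V (p v) (p v').
  have [c ->] := pim v; have [d ->] := pim v'; rewrite !sE.
  by apply/esym/isometric_comb_form; split.
pose U : lmodType K := (W * V)%type.
pose B1 (x y : U) := bs_form W x.1 y.1.
pose B2 (x y : U) := bs_form V (r x.1 + x.2) (r y.1 + y.2).
pose B3 (x y : U) := bs_form V (r x.1) (r y.1).
pose B x y := -1 * B3 x y + (1 * B2 x y + B1 x y).
have lin1 : linear (fun x : U => x.1) by [].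
have lin2 : linear (fun x : U => r x.1 + x.2).
  by move=> c x y /=; rewrite linearP scalerDr addrACA.
have lin3 : linear (fun x : U => r x.1) by move=> c x y /=; rewrite linearP.
have Blin : bilinear_for *%R *%R B.
  apply: bilinear_comb; last apply: bilinear_comb;
    by [apply: (bilinear_pullback lin1); apply: form_bilinear
       |apply: (bilinear_pullback lin2); apply: form_bilinear
       |apply: (bilinear_pullback lin3); apply: form_bilinear].
pose N := space_of Blin.
have CN : in_class k N.
  apply: obeys_comb; last apply: obeys_comb.
  - exact: (obeys_pullback (fun x : U => r x.1) CV).
  - exact: (obeys_pullback (fun x : U => r x.1 + x.2) CV).
  - exact: (obeys_pullback (fun x : U => x.1) CW).
pose g (v : V) : N := (s (p v), v - p v).
pose h (w : W) : N := (w, 0).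
have hom_g : homomorphism (M := LKs V) (N := LKs N) g.
  apply: isometry_homomorphism.
  - move=> c x y; congr pair; rewrite /= ?linearP //.
    by rewrite addrACA scalerBr scalerN.
  - move=> x y [] /(congr1 r); rewrite !rsp => -> /eqP.
    by rewrite subr_eq => /eqP ->; rewrite subrK.
  - move=> x y; rewrite /= /B /B1 /B2 /B3 /= !rsp sp_form ![p _ + _]addrC !subrK.
    by rewrite mulN1r mul1r addrCA addNr addr0.
have hom_h : homomorphism (M := LKs W) (N := LKs N) h.
  apply: isometry_homomorphism.
  - by move=> c x y; congr pair; rewrite /= scaler0 addr0.
  - by move=> x y [].
  - move=> x y; rewrite /= /B /B1 /B2 /B3 /= !addr0.
    by rewrite mulN1r mul1r addKr.
have [_ imm] := ecW (LKs N) h (class_models CN) hom_h.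
move=> /hom_g ga; apply: imm; move: ga; congr sat; apply/funext => i.
by rewrite /g /h /= pa sa subrr.
Qed.

End ECModels.

Lemma extend_ord0 (U : Type) n (x : 'I_n -> U) y : extend x y ord0 = y.
Proof. by rewrite /extend unlift_none. Qed.

Lemma extend_lift (U : Type) n (x : 'I_n -> U) y i :
  extend x y (lift ord0 i) = x i.
Proof. by rewrite /extend liftK. Qed.

Section Combinations.
Variable K : fieldType.

Definition tComb n (c : 'I_n -> K) : term (LK K) n :=
  foldr (fun i t => tAdd (tScale (c i) (Var (LK K) i)) t) (tZero K n) (enum 'I_n).

Lemma eval_comb (V : bilinear_space K) n (a : 'I_n -> V) (c : 'I_n -> K) :
  eval (M := LK_structure V) a (tComb c) = \sum_i c i *: a i.
Proof.
rewrite /tComb -[RHS]big_enum /=.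
by elim: (enum 'I_n) => [|i s IH]; rewrite ?big_nil // big_cons -IH.
Qed.

Lemma homomorphism_isometric (V W : bilinear_space K) (f : V -> W) n (a : 'I_n -> V) :
  homomorphism (M := LK_structure V) (N := LK_structure W) f ->
  isometric a (f \o a).
Proof.
move=> hom; split=> [c|i j]; last first.
  symmetry; apply: (hom _ (Atom (aProd (bs_form V (a i) (a j)) (Var _ i) (Var _ j))) a).
  by [].
rewrite -!eval_comb; split=> [|fc0].
  by apply: (hom _ (Atom (Eq (tComb c) (tZero K n))) a).
by apply: contrapT => /(hom _ (Atom (aNeq (tComb c) (tZero K n))) a); apply.
Qed.

Lemma isometric_extend (V W : bilinear_space K) n (a : 'I_n -> V) (b : 'I_n -> W)
    (v : V) (w : W) : isometric a b ->
    (forall d (c : 'I_n -> K), d *: v + \sum_i c i *: a i = 0 <->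
                               d *: w + \sum_i c i *: b i = 0) ->
    (forall i, bs_form V v (a i) = bs_form W w (b i)) ->
    (forall i, bs_form V (a i) v = bs_form W (b i) w) ->
    bs_form V v v = bs_form W w w ->
  isometric (extend a v) (extend b w).
Proof.
move=> [_ prod] lin vl vr vv.
split=> [c|i j].
  rewrite !big_ord_recl !extend_ord0.
  under eq_bigr do rewrite extend_lift.
  by under [in X in _ <-> X]eq_bigr do rewrite extend_lift.
by case: (unliftP ord0 i) => [i'|] ->; case: (unliftP ord0 j) => [j'|] ->;
  rewrite ?extend_ord0 ?extend_lift.
Qed.

End Combinations.

(** * Rich spaces *)

Section Rich.
Variables (K : fieldType) (k : kind) (V : bilinear_space K).

Definition rich : Prop :=
  forall (N : bilinear_space K) n (a : 'I_n -> V) (b : 'I_n -> N) (w : N),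
    in_class k N -> isometric a b ->
  exists v, isometric (extend a v) (extend b w).

(** The forth half of a back-and-forth: [phi] is positive, so only witnesses
from [N] have to be copied. *)
Lemma rich_transfer (N : bilinear_space K) n (phi : formula (LK K) n)
    (a : 'I_n -> V) (b : 'I_n -> N) :
    rich -> in_class k N -> isometric a b ->
  sat (M := LK_structure N) phi b -> sat (M := LK_structure V) phi a.
Proof.
move=> richV CN; elim: phi a b => {n}
  [n A|||n p IHp q IHq|n p IHp q IHq|n p IHp] a b //= ab.
- by apply: (isometric_atom A ab).2.
- by move=> [/(IHp _ _ ab) ? /(IHq _ _ ab)].
- by move=> [/(IHp _ _ ab)|/(IHq _ _ ab)]; [left|right].
- by move=> [w pw]; have [v vw] := richV _ _ _ _ w CN ab; exists v; apply: IHp vw pw.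
Qed.

Lemma rich_ec : in_class k V -> rich -> ec_model (@T_kind K k) (LK_structure V).
Proof.
move=> CV richV; split; first exact: class_models.
move=> N f NT homf; split=> // n phi a.
have [W CW [R NE RW]] := model_is_weak_space NT; subst N.
have hom_id : homomorphism (M := @Structure (LK K) W (@LK_fun_interp K W) R)
    (N := LK_structure W) id.
  exact: homomorphism_of_atoms.
move=> /hom_id; apply: rich_transfer => //.
by apply: homomorphism_isometric => m psi x /homf /hom_id.
Qed.

End Rich.

(** * The generic space *)

(** A code prescribes the products of a new basis vector with finitely many older
ones, from the left and from the right, and with itself. The codes themselves are the basis of the generic space, so every such prescription is met
by one more basis vector. *)
Inductive code (K : Type) : Type :=
  Code n of ('I_n -> code K) & ('I_n -> K) & ('I_n -> K) & K.
HB.instance Definition _ (K : Type) := gen_eqMixin (code K).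
HB.instance Definition _ (K : Type) := gen_choiceMixin (code K).

Section Generic.
Variables (K : fieldType) (k : kind).

Fixpoint height (g : code K) : nat :=
  let: Code _ old _ _ _ := g in (\max_i height (old i)).+1.

Definition recall (g h : code K) : option (K * K) :=
  let: Code _ old lam mu _ := g in
  omap (fun i => (lam i, mu i)) [pick i | old i == h].

(** The product [h, g] when [g] prescribes l for [g, h] and m for [h, g]: the
law may leave no choice. *)
Definition mirror (l m : K) : K :=
  match k with Arbitrary => m | Symmetric => l | Alternating => - l end.

Definition self_product (g : code K) : K :=
  let: Code _ _ _ _ nu := g in if k is Alternating then 0 else nu.

Definition gram (g h : code K) : K :=
  if g == h then self_product g
  else if recall g h is Some (l, _) then l
  else if recall h g is Some (l, m) then mirror l m
  else 0.

Lemma recall_height g h p : recall g h = Some p -> (height h < height g)%N.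
Proof.
case: g => n old lam mu nu /=; case: pickP => //= i /eqP <- _.
by rewrite ltnS; apply: (leq_bigmax (F := fun j => height (old j))).
Qed.

Lemma recall_asym g h p : recall g h = Some p -> recall h g = None.
Proof.
move=> /recall_height gh; case E: (recall h g) => [q|//].
by have := ltn_trans gh (recall_height E); rewrite ltnn.
Qed.

Definition generic_form (u v : {malg K[code K]}) : K :=
  lin_ext (fun g => lin_ext (gram g) v) u.

Lemma lin_ext_comb (I : choiceType) c (f h : I -> K) (u : {malg K[I]}) :
  lin_ext (fun i => c * f i + h i) u = c * lin_ext f u + lin_ext h u.
Proof.
rewrite /lin_ext !mmapE mulr_sumr -big_split; apply: eq_bigr => i _ /=.
by rewrite mulrDr mulrCA.
Qed.

Lemma generic_bilinear : bilinear_for *%R *%R generic_form.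
Proof.
split=> u c x y; first exact: lin_extP.
rewrite /generic_form -lin_ext_comb; congr lin_ext; apply/funext => g.
exact: lin_extP.
Qed.

(** At most one of two vectors prescribes their products ([recall_asym]), so
that the value is read from the same code in both orders. For alternation the
vanishing of the diagonal concerns the basis only; antisymmetry extends it to
all vectors. *)
Lemma gram_obeys : obeys k (fun g h : code K => gram g h) /\
  (k = Alternating -> forall g h, gram g h = - gram h g).
Proof.
rewrite /gram /mirror; split; case kE: k => //.
- move=> g h; rewrite eq_sym; case: eqP => [->//|_].
  case E: (recall g h) => [[l m]|]; first by rewrite (recall_asym E).
  by case: (recall h g) => [[]|].
- by move=> g; rewrite eqxx; case: g => ? ? ? ? ? /=; rewrite kE.
- move=> _ g h; rewrite eq_sym; case: eqP => [->|_].
    by case: g => ? ? ? ? ? /=; rewrite kE oppr0.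
  case E: (recall g h) => [[l m]|]; first by rewrite (recall_asym E) opprK.
  by case: (recall h g) => [[]|]; rewrite ?oppr0.
Qed.

Lemma generic_obeys : obeys k generic_form.
Proof.
have [] := gram_obeys; rewrite /obeys; case: (k) => // [symG _ u v|altG antiG u].
  rewrite /generic_form /lin_ext !mmapE; under eq_bigr do rewrite mmapE mulr_sumr.
  rewrite exchange_big; apply: eq_bigr => h _ /=.
  by rewrite mmapE mulr_sumr; apply: eq_bigr => g _; rewrite mulrCA symG.
rewrite /generic_form /lin_ext !mmapE; under eq_bigr do rewrite mmapE mulr_sumr.
(* On the diagonal the terms vanish, and off it they cancel in pairs; induction on
   the support extracts the pairs without dividing by 2. *)
elim: (enum_fset _) => [|g s IH]; first by rewrite big_nil.
rewrite big_cons; under eq_bigr do rewrite big_cons.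
rewrite big_cons big_split /= IH altG !mulr0 add0r addr0 -big_split /=.
by rewrite big1 // => h _; rewrite [gram g h]antiG // mulrCA !mulrN addNr.
Qed.

Definition generic_space : bilinear_space K := space_of generic_bilinear.

Lemma generic_in_class : in_class k generic_space.
Proof. exact: generic_obeys. Qed.

Lemma generic_formU g h : bs_form generic_space << g >> << h >> = gram g h.
Proof. by rewrite /= /generic_form !lin_extU. Qed.

Lemma mirrorP (N : bilinear_space K) (x y : N) :
  in_class k N -> bs_form N y x = mirror (bs_form N x y) (bs_form N y x).
Proof.
rewrite /in_class /obeys /mirror; case: (k) => // CN.
exact: alternating_antisym.
Qed.

Lemma self_productP (N : bilinear_space K) (x : N) n old lam mu :
  in_class k N -> self_product (@Code K n old lam mu (bs_form N x x)) = bs_form N x x.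
Proof. by rewrite /in_class /obeys /=; case: (k) => // ->. Qed.

Lemma linear_lin_ext (s : {malg K[code K]} -> K) (u : {malg K[code K]}) :
    (forall c x y, s (c *: x + y) = c * s x + s y) ->
  lin_ext (fun g => s << g >>) u = s u.
Proof.
move=> slin.
pose S : {linear {malg K[code K]} -> K^o} :=
  HB.pack s (GRing.isLinear.Build K _ K^o *:%R s slin).
rewrite -[RHS]/(S u) [u in RHS]monalgE linear_sum /lin_ext mmapE.
apply: eq_bigr => g _ /=; rewrite -[_ * _](linearZ_LR S); congr s.
apply/malgP => h; rewrite mcoeffZ !mcoeffU.
by case: eqP => _; rewrite ?mulr1n ?mulr1 // !mulr0n mulr0.
Qed.

(** If w is a combination of b, copy the combination. Otherwise write w's
products with the support of a into a code: transported by a linear map sending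
a to b, they are a functional on the whole space, hence determined on the basis,
and they give the right products with a. That code is not in the support of a,
so the new basis vector is free from a, as w is from b. *)
Lemma generic_rich : rich k generic_space.
Proof.
move=> N n a b w CN ab.
have [[c wE]|wb] := pselect (exists c : 'I_n -> K, w = \sum_i c i *: b i).
  have single (U : lmodType K) (x : 'I_n -> U) j :
      x j = \sum_i (i == j)%:R *: x i.
    rewrite (bigD1 j) //= eqxx scale1r big1 ?addr0 // => i /negPf ->.
    by rewrite scale0r.
  exists (\sum_i c i *: a i); rewrite wE; apply: isometric_extend => //.
  - move=> d e; rewrite !scaler_sumr -!big_split /=.
    have E (U : lmodType K) (x : 'I_n -> U) :
        \sum_i (d *: (c i *: x i) + e i *: x i) = \sum_i (d * c i + e i) *: x i.
      by apply: eq_bigr => i _; rewrite scalerDl scalerA.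
    by rewrite !E; apply: ab.1.
  - by move=> i; rewrite (single _ a i) (single _ b i); apply: isometric_comb_form.
  - by move=> i; rewrite (single _ a i) (single _ b i); apply: isometric_comb_form.
  - exact: isometric_comb_form.
have [s [sa _]] := tuple_extension (fun c h => (ab.1 c).1 h).
pose S := flatten [seq (msupp (a i) : seq (code K)) | i <- enum 'I_n].
pose old (j : 'I_(size S)) := tnth (in_tuple S) j.
pose g := Code old (fun j => bs_form N w (s << old j >>))
  (fun j => bs_form N (s << old j >>) w) (bs_form N w w).
have Srecall h : h \in S ->
    recall g h = Some (bs_form N w (s << h >>), bs_form N (s << h >>) w).
  move=> hS /=; case: pickP => [j /eqP jh /=|]; first by rewrite jh.
  have lt : (index h S < size S)%N by rewrite index_mem.
  by move=> /(_ (Ordinal lt)); rewrite /old (tnth_nth h) /= nth_index ?eqxx.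
have gS h : h \in S -> g != h.
  by move=> /Srecall E; apply/eqP => gh; have := recall_height E; rewrite gh ltnn.
have aS i h : h \in msupp (a i) -> h \in S.
  move=> hi; apply/flattenP; exists (msupp (a i) : seq (code K)) => //.
  by apply/mapP; exists i; rewrite ?mem_enum.
have ga i : (a i)@_g = 0.
  by apply: mcoeff_outdom; apply/negP => /aS /gS; rewrite eqxx.
exists << g >>; apply: isometric_extend => //.
- move=> d c; split=> [E|].
    have := congr1 (mcoeff g) E.
    rewrite mcoeffD mcoeffZ mcoeffUU mulr1 mcoeff0 raddf_sum big1 ?addr0 => [d0|].
      by move: E; rewrite d0 !scale0r !add0r; apply: (ab.1 c).1.
    by move=> i _; rewrite /= mcoeffZ ga mulr0.
  have [->|d0 E] := eqVneq d 0; first by rewrite !scale0r !add0r; apply: (ab.1 c).2.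
  case: wb; exists (fun i => - (d^-1 * c i)).
  move: E => /(congr1 ( *:%R d^-1)); rewrite scalerDr scalerA mulVf // scale1r.
  move=> /eqP; rewrite scaler0 addr_eq0 => /eqP ->; rewrite scaler_sumr -sumrN.
  by apply: eq_bigr => i _; rewrite scaleNr scalerA.
- move=> i; rewrite /= /generic_form lin_extU.
  rewrite -(sa i) -[RHS](@linear_lin_ext (fun u => bs_form N w (s u))); last first.
    by move=> c x y; rewrite linearP form_linr.
  rewrite /lin_ext !mmapE big_seq [RHS]big_seq; apply: eq_bigr => h /aS hS.
  by rewrite /gram (negPf (gS h hS)) Srecall.
- move=> i; rewrite /= /generic_form.
  rewrite -(sa i) -[RHS](@linear_lin_ext (fun u => bs_form N (s u) w)); last first.
    by move=> c x y; rewrite linearP form_linl.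
  rewrite /lin_ext !mmapE big_seq [RHS]big_seq; apply: eq_bigr => h /aS hS.
  rewrite -/(lin_ext _ _) lin_extU /gram eq_sym (negPf (gS h hS)).
  rewrite (recall_asym (Srecall h hS)) Srecall //.
  by rewrite -mirrorP.
- by rewrite generic_formU /gram eqxx self_productP.
Qed.

Lemma generic_ec : ec_model (@T_kind K k) (LK_structure generic_space).
Proof. exact: rich_ec generic_in_class generic_rich. Qed.

End Generic.

(** * Finite conjunctions and disjunctions *)

Section BigConnectives.
Variables (L : signature) (M : structure L) (n : nat).

Definition bigAnd (I : Type) (s : seq I) (F : I -> formula L n) : formula L n :=
  foldr (fun t => And (F t)) (Top L n) s.
Definition bigOr (I : Type) (s : seq I) (F : I -> formula L n) : formula L n :=
  foldr (fun t => Or (F t)) (Bot L n) s.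

Lemma sat_And (p q : formula L n) (a : 'I_n -> M) :
  sat (And p q) a <-> sat p a /\ sat q a.
Proof. by []. Qed.

Lemma sat_bigAnd (I : eqType) (s : seq I) F (a : 'I_n -> M) :
  sat (bigAnd s F) a <-> forall t, t \in s -> sat (F t) a.
Proof.
elim: s => [//|t s IH] /=; rewrite IH; split=> [[Ft Fs] r|Fs].
  by rewrite inE => /orP[/eqP ->|/Fs].
by split=> [|r rs]; apply: Fs; rewrite inE ?eqxx ?rs ?orbT.
Qed.

Lemma sat_bigOr (I : eqType) (s : seq I) F (a : 'I_n -> M) :
  sat (bigOr s F) a <-> exists2 t, t \in s & sat (F t) a.
Proof.
elim: s => [|t s IH] /=; first by split=> [|[]].
rewrite IH; split=> [[Ft|[r rs Fr]]|[r]].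
- by exists t; rewrite ?inE ?eqxx.
- by exists r; rewrite ?inE ?rs ?orbT.
- by rewrite inE => /orP[/eqP ->|rs Fr]; [left|right; exists r].
Qed.

End BigConnectives.

(** * Finite fields *)

Section Boolean.
Variables (K : fieldType) (k : kind).
Local Notation T := (@T_kind K k).
Local Notation LKs := (@LK_structure K).

(** That psi is the complement of phi is expressed by two h-inductive sentences,
phi and psi -> bot and top -> phi or psi; so if it holds in the e.c. models, it
holds in all models of the Kaiser hull. *)
Lemma boolean_of_negations (L : signature) (T : theory L) :
    (forall n (phi : formula L n), exists psi : formula L n,
      forall M, ec_model T M -> forall a : 'I_n -> M, sat psi a <-> ~ sat phi a) ->
  Boolean T.
Proof.
move=> neg.
have {}neg n (phi : formula L n) : exists psi : formula L n, forall M,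
    models M (kaiser_hull T) -> forall a : 'I_n -> M, sat psi a <-> ~ sat phi a.
  have [psi psiE] := neg n phi; exists psi => M MT a.
  have excl : kaiser_hull T (HSentence (And phi psi) (Bot L n)).
    by move=> N ecN b [/= phib /psiE]; apply.
  have total : kaiser_hull T (HSentence (Top L n) (Or phi psi)).
    move=> N ecN b _ /=; have [|/(psiE _ ecN)] := pselect (sat phi b); first by left.
    by right.
  split=> [psia phia|nphi]; first exact: (MT _ excl a).
  by case: (MT _ total a I).
move=> n chi; elim: chi => {n}
  [n A|n|n|n c [p IHc]|n c [p IHc] d [q IHd]|n c [p IHc] d [q IHd]
  |n c [p IHc] d [q IHd]|n c [p IHc]|n c [p IHc]].
- by exists (Atom A).
- by exists (Top L n).
- by exists (Bot L n).
- by have [q qE] := neg _ p; exists q => M MT a /=; rewrite qE // IHc.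
- by exists (And p q) => M MT a /=; rewrite IHc // IHd.
- by exists (Or p q) => M MT a /=; rewrite IHc // IHd.
- have [r rE] := neg _ p; exists (Or r q) => M MT a /=.
  rewrite IHc // IHd // rE //; split=> [pq|[np|//] /np//].
  by have [/pq|] := pselect (sat p a); [right|left].
- exists (Ex p) => M MT a /=.
  by split=> -[x cx]; exists x; apply/IHc.
- have [r rE] := neg _ p; have [q qE] := neg _ (Ex r); exists q => M MT a /=.
  rewrite qE //=; split=> [all_c [x /rE]|nr x].
    by apply => //; apply/IHc.
  apply/IHc => //; apply: contrapT => np; apply: nr; exists x.
  exact/rE.
Qed.

(** [Theta t] says that a tuple has the pattern [t]; two tuples with the same
pattern are isometric, hence satisfy the same formulas in e.c. models, so [phi]
fails exactly on the patterns on which it fails once. *)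
Lemma boolean_finite : finite_set [set: K] -> Boolean T.
Proof.
move=> /finite_seqP[s sK]; apply: boolean_of_negations => n phi.
pose e (j : 'I_(size s)) := tnth (in_tuple s) j.
have e_onto x : exists j, e j = x.
  have xs : x \in s by have : [set: K] x by []; rewrite sK.
  have lt : (index x s < size s)%N by rewrite index_mem.
  by exists (Ordinal lt); rewrite /e (tnth_nth 0) /= nth_index.
have [num numK] := choice e_onto.
pose qftype : finType := ({ffun {ffun 'I_n -> 'I_(size s)} -> bool} *
  {ffun 'I_n * 'I_n -> 'I_(size s)})%type.
pose rel (c : {ffun 'I_n -> 'I_(size s)}) := tComb (fun i => e (c i)).
pose Theta (t : qftype) := And
  (bigAnd (enum {ffun 'I_n -> 'I_(size s)}) (fun c =>
    Atom (if t.1 c then Eq (rel c) (tZero K n) else aNeq (rel c) (tZero K n))))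
  (bigAnd (enum {: 'I_n * 'I_n}) (fun ij =>
    Atom (aProd (e (t.2 ij)) (Var _ ij.1) (Var _ ij.2)))).
have ThetaP (W : bilinear_space K) (a : 'I_n -> W) t :
    sat (M := LKs W) (Theta t) a <->
    (forall c, t.1 c = (\sum_i e (c i) *: a i == 0)) /\
    (forall i j, bs_form W (a i) (a j) = e (t.2 (i, j))).
  split=> [/sat_And[/sat_bigAnd H1 /sat_bigAnd H2]|[H1 H2]].
    split; last by move=> i j; apply: (H2 (i, j)); rewrite mem_enum.
    move=> c; have := H1 c; rewrite mem_enum => /(_ isT).
    by case: (t.1 c) => /=; rewrite eval_comb => /eqP // /negPf.
  apply/sat_And; split.
  - apply/sat_bigAnd => c _; rewrite /= H1.
    by case: eqP => /= H; rewrite eval_comb.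
  - by apply/sat_bigAnd => -[i j] _; apply: H2.
have Theta_iso (W W' : bilinear_space K) (a : 'I_n -> W) (a' : 'I_n -> W') t :
    sat (M := LKs W) (Theta t) a -> sat (M := LKs W') (Theta t) a' -> isometric a a'.
  move=> /ThetaP[rel_a prod_a] /ThetaP[rel_a' prod_a'].
  split=> [c|i j]; last by rewrite prod_a prod_a'.
  pose d := [ffun i => num (c i)].
  have E (U : lmodType K) (x : 'I_n -> U) :
      \sum_i c i *: x i = \sum_i e (d i) *: x i.
    by apply: eq_bigr => i _; rewrite ffunE numK.
  by rewrite !E; split=> /eqP H; apply/eqP; move: H; rewrite -rel_a -rel_a'.
pose bad (t : qftype) := exists W : bilinear_space K,
  [/\ in_class k W, ec_model T (LKs W) & exists2 a : 'I_n -> W,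
    sat (M := LKs W) (Theta t) a & ~ sat (M := LKs W) phi a].
exists (bigOr [seq t <- enum qftype | `[< bad t >]] Theta) => M ecM a.
have [W CW E] := ec_model_is_space ecM; subst M.
rewrite sat_bigOr; split=> [[t]|nphi].
  rewrite mem_filter => /andP[/asboolP[W' [CW' ecW' [a' ta' nphi']]] _] ta phia.
  apply: nphi'; apply: ec_transfer CW CW' ecW' _ phia.
  exact: Theta_iso ta ta'.
pose t : qftype := ([ffun c : {ffun _ -> _} => \sum_i e (c i) *: (a i : W) == 0],
  [ffun ij => num (bs_form W (a ij.1) (a ij.2))]).
have ta : sat (Theta t) a.
  by apply/ThetaP; split=> [c|i j]; rewrite ffunE ?numK.
exists t => //; rewrite mem_filter mem_enum andbT; apply/asboolP.
by exists W; split=> //; exists a.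
Qed.

End Boolean.

(** * Equality of types is type-definable *)

Section SemiHausdorff.
Variables (K : fieldType) (k : kind).
Local Notation T := (@T_kind K k).
Local Notation LKs := (@LK_structure K).

Definition tSub n (s t : term (LK K) n) : term (LK K) n := tAdd s (tOpp t).

(** Consecutive pairs in the chain (x, x'), (u, x'), (u, u'), (y, u'), (y, y')
share a vector, so the equality of their products is the vanishing of a single
product, and 0 is the only scalar that has to be named. *)
Definition same_product m (x x' y y' : 'I_m) : formula (LK K) m :=
  let v i := Var (LK K) (lift ord0 (lift ord0 i) : 'I_m.+2) in
  let u := Var (LK K) (lift ord0 ord0 : 'I_m.+2) in
  let u' := Var (LK K) (ord0 : 'I_m.+2) in
  Ex (Ex (bigAnd [:: aProd 0 (tSub (v x) u) (v x'); aProd 0 u (tSub (v x') u');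
                     aProd 0 (tSub u (v y)) u'; aProd 0 (v y) (tSub u' (v y'))]
                 (@Atom _ _))).

Lemma sat_same_product (W : bilinear_space K) m (a : 'I_m -> W) x x' y y' :
  sat (M := LKs W) (same_product x x' y y') a <->
  exists u u', [/\ bs_form W (a x) (a x') = bs_form W u (a x'),
    bs_form W u (a x') = bs_form W u u', bs_form W u u' = bs_form W (a y) u' &
    bs_form W (a y) u' = bs_form W (a y) (a y')].
Proof.
have subE (p q : K) : p - q = 0 <-> p = q.
  by split=> [/eqP|->]; rewrite ?subrr // subr_eq0 => /eqP.
split=> /= -[u [u' H]]; exists u, u'; move: H;
  rewrite !extend_lift !extend_ord0 !linearBl !linearBr !subE.
- by case=> ? [? [? [? _]]].
- by case.
Qed.

(** In an extension of [W] one can adjoin u with the same products as x and u'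
with the same products as y', from one side each, and choose [u, u'] to be [x,
x']. With coordinates (w, (al, be)) for w + al u + be u', pulling back the form
along u |-> x, u' |-> y' does all but the last; the product of u and u' is
corrected by subtracting that form on the plane of u and u' and adding the one
pulled back along u |-> x, u' |-> x'. Adding only forms pulled back from [W]
keeps the law. *)
Lemma sat_same_product_ec (W : bilinear_space K) m (a : 'I_m -> W) x x' y y' :
    in_class k W -> ec_model T (LKs W) ->
  sat (M := LKs W) (same_product x x' y y') a <->
  bs_form W (a x) (a x') = bs_form W (a y) (a y').
Proof.
move=> CW [_ ecW]; split=> [/sat_same_product[u [u' [-> -> -> ->]]] //|eq_prod].
pose U : lmodType K := (W * (K^o * K^o))%type.
pose f1 (z : U) : W := z.1 + (z.2.1 *: a x + z.2.2 *: a y').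
pose f2 (z : U) : W := z.2.1 *: a x + z.2.2 *: a y'.
pose f3 (z : U) : W := z.2.1 *: a x + z.2.2 *: a x'.
have lin2 : linear f2.
  by move=> c p q; rewrite /f2 /= !scalerDl -!scalerA scalerDr addrACA.
have lin3 : linear f3.
  by move=> c p q; rewrite /f3 /= !scalerDl -!scalerA scalerDr addrACA.
have lin1 : linear f1.
  move=> c p q; have := lin2 c p q; rewrite /f1 /f2 => -> /=.
  by rewrite [in RHS]scalerDr addrACA.
pose B (z z' : U) := -1 * bs_form W (f2 z) (f2 z') +
  (1 * bs_form W (f1 z) (f1 z') + bs_form W (f3 z) (f3 z')).
have Blin : bilinear_for *%R *%R B.
  have formW := form_bilinear W.
  apply: bilinear_comb; last apply: bilinear_comb.
  - exact: bilinear_pullback lin2 formW.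
  - exact: bilinear_pullback lin1 formW.
  - exact: bilinear_pullback lin3 formW.
pose N := space_of Blin.
have CN : in_class k N.
  apply: obeys_comb; last apply: obeys_comb.
  - exact: (obeys_pullback f2 CW).
  - exact: (obeys_pullback f1 CW).
  - exact: (obeys_pullback f3 CW).
pose h (w : W) : N := (w, (0, 0)).
have f1h w : f1 (h w) = w by rewrite /f1 /= !scale0r !addr0.
have f2h w : f2 (h w) = 0 by rewrite /f2 /= !scale0r addr0.
have f3h w : f3 (h w) = 0 by rewrite /f3 /= !scale0r addr0.
have hom_h : homomorphism (M := LKs W) (N := LKs N) h.
  apply: isometry_homomorphism.
  - move=> c p q; congr pair; rewrite /= (_ : (0, 0) = 0 :> K^o * K^o) //.
    by rewrite scaler0 addr0.
  - by move=> p q [].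
  - move=> p q; rewrite /= /B !f1h !f2h !f3h !linear0l.
    by rewrite mulr0 add0r mul1r addr0.
have [_ imm] := ecW (LKs N) h (class_models CN) hom_h.
apply: imm; apply/sat_same_product; exists (0, (1, 0)), (0, (0, 1)).
have ux z : bs_form N (0, (1, 0)) (h z) = bs_form W (a x) z.
  rewrite /= /B f1h f2h f3h /f1 /f2 /f3 /= !linear0r scale1r !scale0r.
  by rewrite mulr0 !addr0 !add0r mul1r.
have yu z : bs_form N (h z) (0, (0, 1)) = bs_form W z (a y').
  rewrite /= /B f1h f2h f3h /f1 /f2 /f3 /= !linear0l scale1r !scale0r.
  by rewrite mulr0 !addr0 !add0r mul1r.
have uu : bs_form N (0, (1, 0)) (0, (0, 1)) = bs_form W (a x) (a x').
  rewrite /= /B /f1 /f2 /f3 /= !scale1r !scale0r !addr0 !add0r.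
  by rewrite mulN1r mul1r addKr.
have hh z z' : bs_form N (h z) (h z') = bs_form W z z'.
  by rewrite /= /B !f1h !f2h !f3h !linear0l mulr0 add0r mul1r addr0.
have ha i : (h \o a) i = h (a i) by [].
by rewrite uu !ha !ux !yu !hh.
Qed.

Definition same_relation n (c : 'I_n -> K) : formula (LK K) (n + n) :=
  let l := rename (@lshift n n) (tComb c) in
  let r := rename (@rshift n n) (tComb c) in
  let o := tZero K (n + n) in
  Or (And (Atom (Eq l o)) (Atom (Eq r o))) (And (Atom (aNeq l o)) (Atom (aNeq r o))).

Lemma sat_same_relation (W : bilinear_space K) n (a b : 'I_n -> W) c :
  sat (M := LKs W) (same_relation c) (cat_tuples a b) <->
  (\sum_i c i *: a i = 0 <-> \sum_i c i *: b i = 0).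
Proof.
have catl : cat_tuples a b \o @lshift n n = a.
  by apply/funext => i; rewrite /cat_tuples /= (unsplitK (inl i)).
have catr : cat_tuples a b \o @rshift n n = b.
  by apply/funext => i; rewrite /cat_tuples /= (unsplitK (inr i)).
rewrite /= !eval_rename catl catr !eval_comb.
by have [] := pselect (\sum_i c i *: a i = 0);
  have [] := pselect (\sum_i c i *: b i = 0); tauto.
Qed.

Definition same_qftype n : set (formula (LK K) (n + n)) :=
  [set phi | (exists c, phi = same_relation c) \/
    exists i j, phi =
      same_product (lshift n i) (lshift n j) (rshift n i) (rshift n j)].

Lemma same_qftypeP (W : bilinear_space K) n (a b : 'I_n -> W) :
    in_class k W -> ec_model T (LKs W) ->
  (forall phi, same_qftype phi -> sat (M := LKs W) phi (cat_tuples a b)) <->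
  isometric a b.
Proof.
move=> CW ecW.
have catl i : cat_tuples a b (lshift n i) = a i.
  by rewrite /cat_tuples (unsplitK (inl i)).
have catr i : cat_tuples a b (rshift n i) = b i.
  by rewrite /cat_tuples (unsplitK (inr i)).
split=> [sat_all|[rel prod] phi [[c ->]|[i [j ->]]]].
- split=> [c|i j]; first by apply/sat_same_relation/sat_all; left; exists c.
  rewrite -!catl -!catr; apply/sat_same_product_ec => //.
  by apply: sat_all; right; exists i, j.
- exact/sat_same_relation.
- by apply/sat_same_product_ec; rewrite // !catl !catr.
Qed.

Lemma same_type_isometric (W : bilinear_space K) n (a b : 'I_n -> W) :
    in_class k W -> ec_model T (LKs W) ->
  tp (M := LKs W) a = tp (M := LKs W) b <-> isometric a b.
Proof.
move=> CW ecW; split=> [ab|ab]; last first.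
  apply/seteqP; split=> phi; apply: (ec_transfer CW CW ecW) => //.
  exact: isometric_sym.
have sat_ab phi : sat (M := LKs W) phi a <-> sat (M := LKs W) phi b.
  by change (tp (M := LKs W) a phi <-> tp (M := LKs W) b phi); rewrite ab.
split=> [c|i j].
  by rewrite -!eval_comb; apply: (sat_ab (Atom (Eq (tComb c) (tZero K n)))).
symmetry; apply: (sat_ab (Atom (aProd (bs_form W (a i) (a j)) (Var _ i) (Var _ j)))).1.
by [].
Qed.

Lemma semi_Hausdorff_class : semi_Hausdorff T.
Proof.
move=> n; exists (@same_qftype n); split.
  have CG := @generic_in_class K k; have ecG := @generic_ec K k.
  exists (LKs (generic_space K k)); split; first exact: class_models.
  exists (cat_tuples (fun=> 0) (fun=> 0)).
  by apply/same_qftypeP.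
move=> M ecM a b; have [W CW E] := ec_model_is_space ecM; subst M.
by rewrite same_type_isometric // same_qftypeP.
Qed.

End SemiHausdorff.

(** * Mixing the products of two tuples *)

Section Mixing.
Variables (K : fieldType) (k : kind) (V : bilinear_space K).
Local Notation LKs := (@LK_structure K).

(** The final 0 is the form to which [obeys_comb] adds two multiples of that of
[V]. *)
Definition mixed_form (al be : K) (x y : (V * V)%type) : K :=
  al * bs_form V x.1 y.1 + (be * bs_form V x.2 y.2 + 0).

Lemma mixed_bilinear al be : bilinear_for *%R *%R (mixed_form al be).
Proof.
have formV := form_bilinear V.
apply: bilinear_comb; last apply: bilinear_comb.
- by apply: (@bilinear_pullback K (V * V)%type V (fun x => x.1)).
- by apply: (@bilinear_pullback K (V * V)%type V (fun x => x.2)).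
- by split=> u c x y /=; rewrite mulr0 addr0.
Qed.

Definition mixed_space al be : bilinear_space K := space_of (mixed_bilinear al be).

Lemma mixed_in_class al be : in_class k V -> in_class k (mixed_space al be).
Proof.
move=> CV; apply: obeys_comb; last apply: obeys_comb.
- exact: (obeys_pullback (fun x : V * V => x.1) CV).
- exact: (obeys_pullback (fun x : V * V => x.2) CV).
- by case: (k).
Qed.

(** An atom true of two tuples is true of their pair: for a product because al +
be = 1, for an inequality because one coordinate suffices. Conjunctions and
quantifiers are no obstacle, and for a disjunction one of the sides is true for
infinitely many indices; this is where the infinite set is used up. *)
Lemma infinite_mixing n (phi : formula (LK K) n) (S : set K) (a : K -> 'I_n -> V) :
    infinite_set S -> (forall c, S c -> sat (M := LKs V) phi (a c)) ->
  exists2 S' : set K, infinite_set S' /\ S' `<=` S &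
    forall c d al be, S' c -> S' d -> al + be = 1 ->
      sat (M := LKs (mixed_space al be)) phi (fun i => (a c i, a d i)).
Proof.
elim: phi S a => {n}
  [n A|n|n|n p IHp q IHq|n p IHp q IHq|n p IHp] S a infS satS.
- exists S => [|c d al be Sc Sd albe]; first by split.
  have evalP (t : term (LK K) n) : eval (M := LKs (mixed_space al be))
      (fun i => (a c i, a d i)) t =
      (eval (M := LKs V) (a c) t, eval (M := LKs V) (a d) t).
    by elim: t => [//|f ts IH]; case: f ts IH => [| | |x] ts IH /=; rewrite ?IH.
  have := satS c Sc; have := satS d Sd; case: A {satS} => [s t|[|x] ts] /=;
    rewrite !evalP.
  + by move=> -> ->.
  + by move=> neq _ [].
  + by rewrite /mixed_form /= => -> ->; rewrite addr0 -mulrDl albe mul1r.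
- by exists S; first split.
- have [c Sc] := infinite_setN0 infS.
  by have := satS c Sc.
- have [|S1 [inf1 S1S] sat1] := IHp S a infS; first by move=> c /satS[].
  have [|S2 [inf2 S21] sat2] := IHq S1 a inf1; first by move=> c /S1S/satS[].
  exists S2 => [|c d al be Sc Sd albe]; first by split=> // c /S21/S1S.
  by split; [apply: sat1 => //; exact: S21|exact: sat2].
- pose Sp := [set c | S c /\ sat (M := LKs V) p (a c)].
  pose Sq := [set c | S c /\ sat (M := LKs V) q (a c)].
  have [finp|infp] := pselect (finite_set Sp).
    have infq : infinite_set Sq.
      move=> finq; apply: infS; apply: sub_finite_set (_ : finite_set (Sp `|` Sq)).
        by move=> c Sc; case: (satS c Sc); [left|right].
      by rewrite finite_setU.
    have [|S1 [inf1 S1S] sat1] := IHq Sq a infq; first by move=> c [].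
    exists S1 => [|c d al be Sc Sd albe]; first by split=> // c /S1S[].
    by right; apply: sat1.
  have [|S1 [inf1 S1S] sat1] := IHp Sp a infp; first by move=> c [].
  exists S1 => [|c d al be Sc Sd albe]; first by split=> // c /S1S[].
  by left; apply: sat1.
- have wit c : exists w : V, S c -> sat (M := LKs V) p (extend (a c) w).
    have [/satS[w pw]|nS] := pselect (S c); first by exists w.
    by exists 0.
  have [w wP] := choice wit.
  have [S1 [inf1 S1S] sat1] := IHp S (fun c => extend (a c) (w c)) infS wP.
  exists S1 => [//|c d al be Sc Sd albe]; exists (w c, w d).
  have := sat1 c d al be Sc Sd albe; congr sat; apply/funext => i.
  by rewrite /extend; case: unlift.
Qed.

End Mixing.

(** * Infinite fields *)

Section NotHausdorff.
Variables (K : fieldType) (k : kind).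
Local Notation T := (@T_kind K k).
Local Notation LKs := (@LK_structure K).
Local Notation G := (generic_space K k).

Definition root_code : code K :=
  @Code K 0 (fun i => False_rect _ (notF (ltn_ord i)))
  (fun=> 0) (fun=> 0) 0.
Definition witness_code (c : K) : code K :=
  @Code K 1 (fun=> root_code) (fun=> c) (fun=> c) 0.

(** Two independent vectors with product c and all other products as trivial as the
law allows. *)
Definition witness (c : K) : 'I_2 -> G :=
  pair_fun << witness_code c >> << root_code >>.

Lemma witness_recall c : recall (witness_code c) root_code = Some (c, c).
Proof. by rewrite /=; case: pickP => [i|/(_ ord0)]; rewrite ?eqxx. Qed.

Lemma witness_neq c : witness_code c != root_code.
Proof.
apply/eqP => eq; have := recall_height (witness_recall c).
by rewrite eq ltnn.
Qed.

Lemma witness_free c (d : 'I_2 -> K) :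
  \sum_i d i *: witness c i = 0 -> forall i, d i = 0.
Proof.
rewrite big_ord_recl big_ord1 /witness /pair_fun /= => E.
have neq := witness_neq c.
have d0 := congr1 (mcoeff (witness_code c)) E.
have d1 := congr1 (mcoeff root_code) E.
move: d0 d1; rewrite !mcoeffD !mcoeffZ !mcoeffU !eqxx (negPf neq) eq_sym (negPf neq).
rewrite !mulr1n !mulr0n !mulr1 !mulr0 add0r addr0 !mcoeff0 => d0 d1.
by case=> -[|[|//]] lt; [apply: etrans d0|apply: etrans d1];
  congr d; apply: val_inj.
Qed.

Lemma witness_form c i j : bs_form G (witness c i) (witness c j) =
  if i == j then 0 else if i == ord0 then c else mirror k c c.
Proof.
have rec := witness_recall c; have neq := witness_neq c.
have self g : self_product k g = 0 -> gram k g g = 0 by rewrite /gram eqxx.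
case: i => -[|[|//]] ?; case: j => -[|[|//]] ?;
  rewrite /witness /pair_fun -!val_eqE [LHS]generic_formU /=.
- by apply: self; rewrite /=; case: (k).
- by rewrite /gram (negPf neq) rec.
- by rewrite /gram eq_sym (negPf neq) (recall_asym rec) rec.
- by apply: self; rewrite /=; case: (k).
Qed.

Lemma witness_isometric c d al be : al + be = 1 ->
  isometric (V := G) (W := mixed_space G al be) (witness (al * c + be * d))
    (fun i => (witness c i, witness d i)).
Proof.
move=> albe; split=> [e|i j].
  have zero (U : lmodType K) (x : 'I_2 -> U) :
      (forall i, e i = 0) -> \sum_i e i *: x i = 0.
    by move=> e0; rewrite big1 // => i _; rewrite e0 scale0r.
  split=> [/witness_free/zero //|/(congr1 fst)].
  rewrite (big_morph fst (fun _ _ => erefl) erefl) /= => E.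
  by apply: zero; apply: (@witness_free c).
rewrite [RHS](_ : _ = al * bs_form G (witness c i) (witness c j) +
  (be * bs_form G (witness d i) (witness d j) + 0)) // addr0 !witness_form.
case: eqP => _; first by rewrite !mulr0 addr0.
case: eqP => _ //; rewrite /mirror; case: (k) => //.
by rewrite !mulrN -opprD.
Qed.

(** Write c = al d + (1 - al) e for indices d, e given by [infinite_mixing]. *)
Lemma infinite_everywhere (phi : formula (LK K) 2) c :
  infinite_set [set d | sat (M := LKs G) phi (witness d)] ->
  sat (M := LKs G) phi (witness c).
Proof.
move=> infS; have [S [infS' _] satS] := infinite_mixing infS (fun _ => id).
have [d Sd] := infinite_setN0 infS'.
have [e [Se ed]] : S `\` [set d] !=set0.
  exact/infinite_setN0/infinite_setD.
have de : d - e != 0 by rewrite subr_eq0; apply/eqP => de; apply: ed.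
pose al := (c - e) / (d - e).
have albe : al + (1 - al) = 1 by rewrite addrC subrK.
have -> : c = al * d + (1 - al) * e.
  by rewrite mulrBl mul1r addrCA addrC -mulrBr divfK // subrK.
apply: rich_transfer (@generic_rich K k) _ (witness_isometric d e albe) _.
  exact/mixed_in_class/generic_in_class.
exact: satS.
Qed.

Lemma not_Hausdorff_class : infinite_set [set: K] -> ~ Hausdorff T.
Proof.
move=> infK haus.
have ecG := @generic_ec K k.
have isT c : is_type T (tp (M := LKs G) (witness c)).
  by exists (LKs G); split=> //; exists (witness c).
have neq : tp (M := LKs G) (witness 0) <> tp (M := LKs G) (witness 1).
  pose phi := Atom (aProd (0 : K) (Var (LK K) (ord0 : 'I_2)) (Var (LK K) ord_max)).
  have satE c : tp (M := LKs G) (witness c) phi <-> c = 0.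
    rewrite (_ : tp _ phi = (bs_form G (witness c ord0) (witness c ord_max) = 0)) //.
    by rewrite witness_form.
  move=> E; have := (satE 0).2 erefl; rewrite E => /satE/eqP.
  by rewrite oner_eq0.
have [phi [psi [nphi npsi total]]] := haus 2 _ _ (isT 0) (isT 1) neq.
have {}total c : sat (M := LKs G) phi (witness c) \/ sat (M := LKs G) psi (witness c).
  exact: (total (LKs G) (fun s hull_s => hull_s _ ecG) (witness c)).
have [fin|/(infinite_everywhere 0)//] :=
    pselect (finite_set [set c | sat (M := LKs G) phi (witness c)]).
have [fin'|/(infinite_everywhere 1)//] :=
    pselect (finite_set [set c | sat (M := LKs G) psi (witness c)]).
apply: infK; apply: sub_finite_set (_ : finite_set (
    [set c | sat (M := LKs G) phi (witness c)] `|`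
    [set c | sat (M := LKs G) psi (witness c)])).
  by move=> c _; apply: total.
by rewrite finite_setU.
Qed.

End NotHausdorff.

Theorem proposition4p14 (K : fieldType) (T : theory (LK K))
    (hT : T = T_bil K \/ T = T_sym K \/ T = T_alt K) :
  (finite_set [set: K] -> Boolean T) /\
  (infinite_set [set: K] -> semi_Hausdorff T /\ ~ Hausdorff T).
Proof.
suff [k ->] : exists k, T = @T_kind K k.
  split; first exact: boolean_finite.
  by split; [exact: semi_Hausdorff_class|exact: not_Hausdorff_class].
by case: hT => [|[]] ->; [exists Arbitrary|exists Symmetric|exists Alternating].
Qed.
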